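(* Let $n\ge 1$ be an integer, let $(\mathcal{A},\varphi)$ be a $*$-probability space, let $\{e_{ij}\}_{i,j=1}^n\subseteq\mathcal{A}$ be a family of matrix units of $\mathcal{A}$, and let $x=x^*\in\mathcal{A}$ be freely independent from $\{e_{ij}\}_{i,j=1}^n$. Let $x_{ij}:=e_{1i}\,x\,e_{j1}\in\tilde{\mathcal{A}}$ and $$\tilde{x}^\Gamma:=\sum_{i,j=1}^n E_{ij}\otimes x_{ji}\in\mathcal{M}_n(\mathbb{C})\otimes\tilde{\mathcal{A}}.$$ Then for every integer $p\ge 1$, the $p$-th free cumulant of $\tilde{x}^\Gamma$ computed in the $*$-probability space $(\mathcal{M}_n(\mathbb{C})\otimes\tilde{\mathcal{A}},\ \mathrm{tr}_n\otimes\psi)$ and the $p$-th free cumulant of $x/n$ computed in $(\mathcal{A},\varphi)$ satisfy $$\kappa_p\big[\tilde{x}^\Gamma,\ldots,\tilde{x}^\Gamma\big]=c(n,p)\,\kappa_p\Big[\tfrac{x}{n},\ldots,\tfrac{x}{n}\Big],\qquad c(n,p)=\begin{cases} n, & p\ \text{odd},\\ n^2, & p\ \text{even}.\end{cases}$$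
   Context: A $*$-probability space $(\mathcal{A},\varphi)$ is a unital $*$-algebra $\mathcal{A}$ over $\mathbb{C}$ with a positive linear functional $\varphi$ satisfying $\varphi(\mathbf{1}_{\mathcal{A}})=1$. A family $\{e_{ij}\}_{i,j=1}^n\subseteq\mathcal{A}$ is a family of matrix units of $\mathcal{A}$ if (i) $e_{ij}^*=e_{ji}$ and $e_{ij}e_{kl}=\delta_{jk}e_{il}$ for all $i,j,k,l$; (ii) $\sum_{i=1}^n e_{ii}=\mathbf{1}_{\mathcal{A}}$; (iii) $\varphi(e_{ij})=0$ for $i\ne j$ and $\varphi(e_{11})=\cdots=\varphi(e_{nn})=1/n$. The compression of $(\mathcal{A},\varphi)$ by $e_{11}$ is $(\tilde{\mathcal{A}},\psi)$ with $\tilde{\mathcal{A}}:=e_{11}\mathcal{A}e_{11}$ (unit $e_{11}$) and $\psi:=n\cdot\varphi|_{\tilde{\mathcal{A}}}$; it is a $*$-probability space. $\{E_{ij}\}$ denotes the standard matrix units of $\mathcal{M}_n(\mathbb{C})$ and $\mathrm{tr}_n=\frac1n\mathrm{Tr}$. For a $*$-probability space $(\mathcal{B},\phi)$, the free cumulants $(\kappa_p)_{p\ge1}$ are the unique multilinear functionals such that for all $p$ and $y_1,\dots,y_p\in\mathcal{B}$, $\phi(y_1\cdots y_p)=\sum_{\pi\in NC(p)}\kappa_\pi[y_1,\ldots,y_p]$, where $NC(p)$ is the set of non-crossing partitions of $\{1,\dots,p\}$ and $\kappa_\pi[y_1,\dots,y_p]=\prod_{V=\{i_1<\dots<i_r\}\in\pi}\kappa_r[y_{i_1},\dots,y_{i_r}]$.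 *)

(* Defs.v *)
From HB Require Import structures.
From mathcomp Require Import all_boot all_order all_algebra.
Set Implicit Arguments. Unset Strict Implicit. Unset Printing Implicit Defensive.
Import Order.TTheory GRing.Theory Num.Theory.
Local Open Scope ring_scope.

Definition is_star (C : numClosedFieldType) (A : algType C) (star : A -> A) :=
  [/\ forall a b : A, star (a + b) = star a + star b,
      forall (c : C) (a : A), star (c *: a) = c^* *: star a,
      forall a b : A, star (a * b) = star b * star a
    & forall a : A, star (star a) = a].

Definition star_prob_space (C : numClosedFieldType) (A : algType C)
    (star : A -> A) (phi : A -> C) :=
  [/\ is_star star,
      forall (c : C) (a b : A), phi (c *: a + b) = c * phi a + phi b,
      forall a : A, 0 <= phi (star a * a)
    & phi 1 = 1].

Definition matrix_units (C : numClosedFieldType) (A : algType C)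
    (star : A -> A) (phi : A -> C) (n : nat) (e : 'I_n -> 'I_n -> A) :=
  [/\ (forall i j, star (e i j) = e j i),
      (forall i j k l, e i j * e k l = if j == k then e i l else 0),
      \sum_(i < n) e i i = 1,
      (forall i j, i != j -> phi (e i j) = 0)
    & (forall i, phi (e i i) = n%:R^-1)].

(* Two unital subalgebras given by membership predicates A1, A2 are free
   when phi(a_1 ... a_k) = 0 whenever k >= 1, each a_j is centred and the
   a_j belong alternately to A1 and A2 (consecutive indices distinct; with
   two algebras this means strict alternation, starting with either one). *)
Definition free_pair (C : numClosedFieldType) (A : algType C) (phi : A -> C)
    (A1 A2 : A -> Prop) :=
  forall (s : seq A) (b : bool), (0 < size s)%N ->
    (forall i, (i < size s)%N ->
       if odd i (+) b then A1 (nth 0 s i) else A2 (nth 0 s i)) ->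
    (forall a, a \in s -> phi a = 0) ->
    phi (\prod_(a <- s) a) = 0.

(* the unital algebra generated by x (x selfadjoint, so it is a *-algebra) *)
Definition alg_gen1 (C : numClosedFieldType) (A : algType C) (x : A) (a : A) :=
  exists q : {poly C}, a = \sum_(i < size q) q`_i *: x ^+ i.

(* the algebra generated by the matrix units = their linear span *)
Definition span_units (C : numClosedFieldType) (A : algType C) (n : nat)
    (e : 'I_n -> 'I_n -> A) (a : A) :=
  exists c : 'I_n -> 'I_n -> C, a = \sum_(i < n) \sum_(j < n) c i j *: e i j.

Definition noncrossing (p : nat) (P : {set {set 'I_p}}) :=
  [forall V in P, forall W in P, forall a : 'I_p, forall b : 'I_p,
     forall c : 'I_p, forall d : 'I_p,
       ((V != W) && [&& (a < b)%N, (b < c)%N & (c < d)%N]) ==>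
       ~~ [&& a \in V, c \in V, b \in W & d \in W]].

Definition NCpart (p : nat) (P : {set {set 'I_p}}) :=
  partition P [set: 'I_p] && noncrossing P.

(* kappa s stands for kappa_{size s}[s_1,...,s_p].  The space is given by a
   carrier B (a Z-module), a scalar action of C, a product, a unit, a
   functional phi and a predicate S singling out the elements of the space
   (S = predT for a space that is a whole type).  The block V = {i_1<..<i_r}
   contributes kappa [y_{i_1}, ..., y_{i_r}] (enum of a set of ordinals is
   increasing). *)
Definition kappa_pi (B : zmodType) (C : numClosedFieldType)
    (kappa : seq B -> C) (s : seq B) (P : {set {set 'I_(size s)}}) : C :=
  \prod_(V in P) kappa [seq nth 0 s (val i) | i <- enum V].

Definition free_cumulants (C : numClosedFieldType) (B : zmodType)
    (scale : C -> B -> B) (mul : B -> B -> B) (one : B) (S : pred B)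
    (phi : B -> C) (kappa : seq B -> C) :=
  (forall (s1 s2 : seq B) (c : C) (u v : B),
      all S s1 -> all S s2 -> S u -> S v ->
      kappa (s1 ++ (scale c u + v) :: s2)
        = c * kappa (s1 ++ u :: s2) + kappa (s1 ++ v :: s2)) /\
  (forall s : seq B, all S s -> (0 < size s)%N ->
      phi (foldr mul one s)
        = \sum_(P : {set {set 'I_(size s)}} | NCpart P) kappa_pi kappa P).

(* A~ = e11 A e11 (unit e11), psi = n * phi|_{A~}.  The algebraic tensor
   product M_n(C) (x) A~ is realised as n x n matrices with entries in A~
   (E_ij (x) a  <->  the matrix with a at (i,j)); its product is the matrix
   product, its unit the diagonal matrix e11%:M, and tr_n (x) psi becomes
   M |-> n^-1 * sum_i psi (M i i). *)
Definition psi (C : numClosedFieldType) (A : algType C) (phi : A -> C)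
  (n : nat) (a : A) : C := n%:R * phi a.

Definition in_corner_mx (C : numClosedFieldType) (A : algType C) (n : nat)
    (e11 : A) (M : 'M[A]_n) : bool :=
  [forall i, forall j, e11 * M i j * e11 == M i j].

Definition scale_mx (C : numClosedFieldType) (A : algType C) (n : nat)
    (c : C) (M : 'M[A]_n) : 'M[A]_n := \matrix_(i, j) (c *: M i j).

Definition tr_psi (C : numClosedFieldType) (A : algType C) (phi : A -> C)
    (n : nat) (M : 'M[A]_n) : C :=
  n%:R^-1 * \sum_(i < n) psi phi n (M i i).

(* x_ij = e_{1i} x e_{j1};  x~^Gamma = sum_{i,j} E_ij (x) x_ji, i.e. the
   matrix whose (i,j) entry is x_ji = e_{1j} x e_{i1}.  [o] is the index 1. *)
Definition xGamma (C : numClosedFieldType) (A : algType C) (n : nat)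
    (e : 'I_n -> 'I_n -> A) (o : 'I_n) (x : A) : 'M[A]_n :=
  \matrix_(i, j) (e o j * x * e i o).

(* Main.v *)
Require Import Defs.
From HB Require Import structures.
From mathcomp Require Import all_boot all_order all_algebra.
From mathcomp Require Import zify ring.
From Stdlib Require Import FunctionalExtensionality.
Import Order.TTheory GRing.Theory Num.Theory.
Local Open Scope ring_scope.
Set Implicit Arguments. Unset Strict Implicit. Unset Printing Implicit Defensive.

(** Removing the block of the first point from a non-crossing partition shows
    that the moments of a sequence of cumulants [k] count Lukasiewicz paths:
    a step up by [s - 1] has weight [k s], a step down has weight 1.  This is
    also the action of [x] on a full Fock space over the matrix units, whose
    basis vectors are stacks of matrices: [x] pushes [s - 1] identity matrices
    (weight [k s]) or pops the top [t] (weight [tr_n t]), and a matrix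
    multiplies the top.  Centring the letters one at a time, freeness gives
    [phi w] as the vacuum expectation of any word [w] in [x] and the [e i j].

    Expanding the partial transpose, its [p]-th moment is the sum over the
    indices of the words [e_{1 i2} x e_{i1 i3} x e_{i2 i4} x ... x e_{ip 1}].
    In the stack picture, the current pair of indices is swapped whenever a
    gap of a block is closed, so summing over the indices attaches to a block
    of size [s] the factor [n ^ - s] times [n] ([s] odd, one free index) or
    [n ^ 2] ([s] even, two free indices).  The moments are thus those of the
    cumulants [weight s], and moments determine cumulants. *)

(** * Non-crossing partitions and paths *)

Section Paths.
Variables (R : comNzRingType) (k : nat -> R) (N : nat).

(* Steps up by [s >= N] are cut off, to keep the sums finite. *)
Definition path_step (f : nat -> R) (h : nat) : R :=
  \sum_(s < N) k s.+1 * f (h + s)%N + (if h is h'.+1 then f h' else 0).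

Definition path_sum (q : nat) : nat -> R :=
  iter q path_step (fun h => (h == 0%N)%:R).

Arguments path_sum : simpl never.

Lemma path_sum0 h : path_sum 0 h = (h == 0%N)%:R.
Proof. by []. Qed.

Lemma path_sumS q h :
  path_sum q.+1 h = \sum_(s < N) k s.+1 * path_sum q (h + s)%N
                    + (if h is h'.+1 then path_sum q h' else 0).
Proof. by []. Qed.

(** A step goes down by at most one. This is what makes the cut-off of the up-steps at [N]
    harmless. *)
Lemma path_sum_gt q h : (q < h)%N -> path_sum q h = 0.
Proof.
elim: q h => [|q IH] [|h] // qh; rewrite path_sumS IH // addr0 big1 // => s _.
by rewrite IH ?mulr0 // (leq_trans (ltnW qh)) // leq_addr.
Qed.

(* Cut a path at its first descent below its starting level. *)
Lemma path_sum_cut q a h :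
  path_sum q (a + h).+1 =
  \sum_(t < q) path_sum t a * path_sum (q - t.+1) h.
Proof.
elim: q a => [|q IH] a; first by rewrite big_ord0.
rewrite path_sumS big_ord_recl subSS subn0.
under [X in X + _ = _]eq_bigr => s _.
  rewrite addSn addnAC IH mulr_sumr.
  under eq_bigr do rewrite mulrA.
over.
rewrite exchange_big /=.
under [X in _ = _ + X]eq_bigr => t _.
  rewrite /bump /= add1n subSS path_sumS mulrDl mulr_suml.
over.
rewrite big_split /= path_sum0 [in RHS]addrCA; congr (_ + _).
(* The isolated term [t = 0] is a path whose very first step is the descent, which forces [a = 0];
   for positive [a] a first step down falls under the induction hypothesis. *)
case: a => [|a]; last by rewrite mul0r add0r addSn IH.
by rewrite mul1r big1 ?addr0 // => t _; rewrite mul0r.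
Qed.

End Paths.

Arguments path_sum : simpl never.

(** * Recursion for weighted sums over non-crossing partitions *)

Section NCRec.
Variables (R : comNzRingType) (k : nat -> R) (p : nat).
Implicit Types (V W : {set 'I_p}) (P : {set {set 'I_p}}) (S : {set 'I_p}).

Definition ncp S P := partition P S && noncrossing P.

Definition itv (i j : nat) : {set 'I_p} := [set x : 'I_p | (i <= x < j)%N].

Lemma noncrossingP P :
  reflect (forall V W (a b c d : 'I_p), V \in P -> W \in P ->
             (a < b)%N -> (b < c)%N -> (c < d)%N ->
             a \in V -> c \in V -> b \in W -> d \in W -> V = W)
          (noncrossing P).
Proof.
apply: (iffP idP) => [nc V W a b c d VP WP ab bc cd aV cV bW dW|nc].
  move/forallP/(_ V)/implyP/(_ VP)/forallP/(_ W)/implyP/(_ WP): nc.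
  move/forallP/(_ a)/forallP/(_ b)/forallP/(_ c)/forallP/(_ d)/implyP.
  by case: eqVneq => //= _; rewrite ab bc cd aV cV bW dW => /(_ isT).
apply/forallP => V; apply/implyP => VP; apply/forallP => W; apply/implyP => WP.
apply/forallP => a; apply/forallP => b; apply/forallP => c; apply/forallP => d.
apply/implyP => /andP[VW /and3P[ab bc cd]]; apply: contra VW.
by case/and4P=> aV cV bW dW; apply/eqP; apply: (nc V W a b c d).
Qed.

Lemma partitionP P S :
  reflect [/\ forall V, V \in P -> V \subset S,
              forall x, x \in S -> exists2 V, V \in P & x \in V,
              forall V W x, V \in P -> W \in P -> x \in V -> x \in W -> V = W
            & set0 \notin P]
          (partition P S).
Proof.
apply: (iffP and3P) => [[/eqP cP tP P0]|[sP cP tP P0]].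
  split=> // [V VP|x|V W x VP WP xV xW].
  - by rewrite -cP; apply: bigcup_sup VP.
  - by rewrite -cP => /bigcupP.
  - by rewrite -(def_pblock tP VP xV) -(def_pblock tP WP xW).
split=> //.
  rewrite eqEsubset; apply/andP; split; first exact/bigcupsP.
  by apply/subsetP => x /cP[V VP xV]; apply/bigcupP; exists V.
apply/trivIsetP => V W VP WP; apply: contraR => /pred0Pn[x /andP[xV xW]].
by apply/eqP; apply: tP xV xW.
Qed.

(* The weight of [V] when [i] counts for [r.+1] points. *)
Definition wt (r : nat) (i : 'I_p) V : R := k (#|V| + (i \in V) * r)%N.

Definition nc_sum S : R := \sum_(P | ncp S P) \prod_(V in P) k #|V|.

(** The multiplicity of [i] remembers the points of its block that have been read already, so that a
    block can be consumed one point at a time. *)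
Definition nc_sum_at r i S : R := \sum_(P | ncp S P) \prod_(V in P) wt r i V.

Lemma nc_sum_at0 i S : nc_sum_at 0 i S = nc_sum S.
Proof.
by apply: eq_bigr => P _; apply: eq_bigr => V _; rewrite /wt muln0 addn0.
Qed.

Lemma nc_sum0 : nc_sum set0 = 1.
Proof.
rewrite /nc_sum (bigD1 (set0 : {set {set 'I_p}})) /=; last first.
  apply/andP; split; first by rewrite partition_set0.
  by apply/noncrossingP => V W a b c d; rewrite inE.
rewrite big_set0 big1 ?addr0 // => P /andP[/andP[+ _]].
by rewrite partition_set0 => ->.
Qed.


(* [l] is the successor of [i] in its block, or [l = i] if there is none. *)
Definition next_of (i : 'I_p) P (l : 'I_p) : bool :=
  if l == i then [set i] \in P else
  (i < l)%N &&
  [exists V in P, [&& i \in V, l \in V & [forall y in V, ~~ (i < y < l)%N]]].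

Lemma next_ofP (i l : 'I_p) P : i != l ->
  reflect ((i < l)%N /\ exists V, [/\ V \in P, i \in V, l \in V
                            & forall y, y \in V -> ~~ (i < y < l)%N])
          (next_of i P l).
Proof.
rewrite /next_of eq_sym => /negPf ->.
apply: (iffP andP) => -[il]; split=> //.
  case/existsP: b => V /andP[VP /and3P[iV lV /forallP nV]].
  by exists V; split=> // y yV; move/implyP: (nV y); apply.
case: b => V [VP iV lV nV]; apply/existsP; exists V; rewrite VP iV lV /=.
by apply/forallP => y; apply/implyP; apply: nV.
Qed.

(** The block of [i], the first point, is a singleton or has a least point above [i]. Sorting the
    partitions by [l] therefore counts each of them exactly once. *)
Lemma next_of_unique (i : 'I_p) (j : nat) P :
  (i < j)%N -> partition P (itv i j) ->
  exists2 l0 : 'I_p, (i <= l0 < j)%N & forall l, next_of i P l = (l == l0).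
Proof.
move=> ij /partitionP[sP cP tP P0].
have [|V VP iV] := cP i; first by rewrite inE leqnn.
have geV y : y \in V -> (i <= y < j)%N.
  by move=> yV; have:= subsetP (sP V VP) y yV; rewrite inE.
have [Vi|] := eqVneq V [set i].
  exists i; rewrite ?leqnn // => l; rewrite eq_sym.
  have [<-|il] := eqVneq i l; first by rewrite /next_of eqxx -Vi.
  apply/negP => /(next_ofP _ il)[_ [W [WP iW lW _]]].
  by move: lW; rewrite -(tP V W i) // Vi inE eq_sym (negPf il).
move=> Vi; have [z zV iz] : exists2 z, z \in V & (i < z)%N.
  have /subsetPn[z zV zi] : ~~ (V \subset [set i]).
    by apply: contra Vi => Vi; rewrite eqEsubset Vi sub1set.
  exists z => //; rewrite ltn_neqAle; case/andP: (geV z zV) => -> _.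
  by rewrite andbT eq_sym -[_ == _ :> nat]/(z == i) -in_set1.
case: (@arg_minnP _ z (fun y => (y \in V) && (i < y)%N) (fun y => val y)).
  by rewrite zV iz.
move=> l0 /andP[l0V il0] minl0; exists l0.
  by case/andP: (geV _ l0V) => -> ->.
move=> l; have [->|il] := eqVneq l i.
  rewrite /next_of eqxx; have /negPf -> : i != l0.
    by apply: contraTneq il0 => <-; rewrite ltnn.
  apply/negP => iP; case/eqP: Vi; apply: (tP V [set i] i) => //.
  by rewrite inE.
rewrite eq_sym in il; apply/(next_ofP _ il)/eqP => [[lti [W [WP iW lW nW]]]|->].
  have VW := tP V W i VP WP iV iW; rewrite -{W}VW in WP iW lW nW.
  have le0 := minl0 l; rewrite lW lti in le0.
  have := nW l0 l0V; rewrite il0 /= -leqNgt => le1.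
  by apply/val_inj/eqP; rewrite eqn_leq le1 le0.
split=> //; exists V; split=> // y yV; apply/negP => /andP[iy yl0].
by have := minl0 y; rewrite yV iy leqNgt yl0 => /(_ isT).
Qed.


Lemma sum_bij (I J : finType) (h : J -> I) (h' : I -> J) (P : pred I)
    (Q : pred J) (F : I -> R) :
    (forall i, P i -> Q (h' i) /\ h (h' i) = i) ->
    (forall j, Q j -> P (h j) /\ h' (h j) = j) ->
  \sum_(i | P i) F i = \sum_(j | Q j) F (h j).
Proof.
move=> PQ QP; rewrite (reindex_onto h h'); last by move=> i /PQ[].
apply: eq_bigl => j; apply/andP/idP => [[Pj /eqP <-]|/QP[-> ->]] //.
by case/PQ: Pj.
Qed.

(** A singleton crosses nothing, so removing it is a bijection onto the non-crossing partitions of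
    the remaining points. *)
Lemma nc_sum_singleton r (i : 'I_p) (j : nat) : (i < j)%N ->
  \sum_(P | ncp (itv i j) P && ([set i] \in P)) \prod_(V in P) wt r i V
  = k r.+1 * nc_sum (itv i.+1 j).
Proof.
move=> ij; pose h P := [set i] |: P; pose h' P := P :\ [set i].
rewrite (@sum_bij _ _ h h' _ (ncp (itv i.+1 j))).
- rewrite /nc_sum mulr_sumr; apply: eq_bigr => P /andP[/partitionP[sP _ _ _] _].
  have niP V : V \in P -> i \notin V.
    by move=> VP; apply/negP => /(subsetP (sP V VP)); rewrite inE ltnn.
  rewrite big_setU1 /=; last by apply/negP => /niP; rewrite inE eqxx.
  congr (_ * _); first by rewrite /wt cards1 inE eqxx mul1n add1n.
  by apply: eq_bigr => V VP; rewrite /wt (negPf (niP V VP)) mul0n addn0.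
- move=> P /andP[/andP[/partitionP[sP cP tP P0] /noncrossingP nc] iP].
  split; last by rewrite /h /h' setD1K.
  have niP V : V \in P -> V != [set i] -> i \notin V.
    move=> VP; apply: contra => iV; apply/eqP; apply: (tP V _ i) => //.
    by rewrite inE.
  apply/andP; split; last first.
    apply/noncrossingP => V W a b c d; rewrite !inE => /andP[_ VP] /andP[_ WP].
    exact: nc.
  apply/partitionP; split.
  + move=> V; rewrite !inE => /andP[Vi VP]; apply/subsetP => x xV.
    have := subsetP (sP V VP) x xV; rewrite !inE => /andP[ix ->].
    rewrite andbT ltn_neqAle ix andbT; apply: contraTneq xV => eix; rewrite -(val_inj eix).
    exact: niP.
  + move=> x; rewrite inE => /andP[ix xj].
    have [|V VP xV] := cP x; first by rewrite inE xj (ltnW ix).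
    exists V => //; rewrite !inE VP andbT; apply: contraTneq xV => ->.
    by rewrite inE; apply: contraTneq ix => ->; rewrite ltnn.
  + by move=> V W x; rewrite !inE => /andP[_ VP] /andP[_ WP]; apply: tP.
  + by rewrite !inE (negPf P0) andbF.
- move=> P /andP[/partitionP[sP cP tP P0] /noncrossingP nc].
  have niP V x : V \in P -> x \in V -> (i < x < j)%N.
    by move=> VP /(subsetP (sP V VP)); rewrite inE.
  have nPi : [set i] \notin P.
    by apply/negP => iP; have := niP _ _ iP (set11 i); rewrite ltnn.
  split; last by rewrite /h /h' setU1K.
  rewrite /h setU11 andbT; apply/andP; split; last first.
    apply/noncrossingP => V W a b c d.
    case/setU1P=> [->|VP] /setU1P[->|WP] ab bc cd //; last exact: nc.
      by rewrite !inE => /eqP ai /eqP ci; move: (ltn_trans ab bc);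
         rewrite ai ci ltnn.
    move=> _ _; rewrite !inE => /eqP bi /eqP di; move: (ltn_trans bc cd).
    by rewrite bi di ltnn.
  apply/partitionP; split.
  + move=> V /setU1P[->|VP]; apply/subsetP => x.
      by rewrite !inE => /eqP->; rewrite leqnn.
    by move/(niP _ _ VP); rewrite inE => /andP[/ltnW -> ->].
  + move=> x; rewrite inE leq_eqVlt => /andP[/orP[/eqP/val_inj <-|ix] xj].
      by exists [set i]; rewrite ?inE ?eqxx.
    have [|V VP xV] := cP x; first by rewrite inE ix.
    by exists V => //; rewrite !inE VP orbT.
  + move=> V W x /setU1P[->|VP] /setU1P[->|WP] //; last exact: tP.
      by rewrite inE => /eqP -> /(niP _ _ WP); rewrite ltnn.
    by move=> xV; rewrite inE => /eqP xi; move: (niP _ _ VP xV); rewrite xi ltnn.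
  + rewrite !inE (negPf P0) orbF eq_sym; apply/negP => /eqP/setP/(_ i).
    by rewrite !inE eqxx.
Qed.


(** * Partitions in which [l] follows [i] in its block *)

Section Split.
Variables (r : nat) (i l : 'I_p) (j : nat).
Hypotheses (il : (i < l)%N) (lj : (l < j)%N).

Definition adjoin V := if l \in V then i |: V else V.

(** A block meeting the gap between [i] and [l] cannot leave it without crossing the block of [i]
    and [l]. Outside the gap [i] carries no information, as it belongs to the block of [l]; it is
    thus dropped by [cut] and restored by [adjoin]. *)
Definition glue (Ps : {set {set 'I_p}} * {set {set 'I_p}}) :=
  Ps.1 :|: adjoin @: Ps.2.

Definition cut P :=
  ([set V in P | V \subset itv i.+1 l],
   [set V :\ i | V in P & ~~ (V \subset itv i.+1 l)]).

Let i_neq_l : i != l.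
Proof. by apply: contraTneq il => ->; rewrite ltnn. Qed.

Lemma sub_adjoin V x : x \in V -> x \in adjoin V.
Proof. by rewrite /adjoin; case: ifP => // _ xV; rewrite !inE xV orbT. Qed.

Lemma in_adjoin V x : x \in adjoin V -> x \in V \/ x = i /\ l \in V.
Proof.
rewrite /adjoin; case: ifP => lV; last by left.
by case/setU1P; [right | left].
Qed.

Lemma glueK P1 P2 : ncp (itv i.+1 l) P1 -> ncp (itv l j) P2 ->
  ncp (itv i j) (glue (P1, P2)) && next_of i (glue (P1, P2)) l
  /\ cut (glue (P1, P2)) = (P1, P2).
Proof.
move=> /andP[/partitionP[s1 c1 t1 n1] /noncrossingP nc1].
move=> /andP[/partitionP[s2 c2 t2 n2] /noncrossingP nc2].
have r1 V x : V \in P1 -> x \in V -> (i < x < l)%N.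
  by move=> VP /(subsetP (s1 V VP)); rewrite inE.
have r2 V x : V \in P2 -> x \in V -> (l <= x < j)%N.
  by move=> VP /(subsetP (s2 V VP)); rewrite inE.
have ar V x : V \in P2 -> x \in adjoin V -> x != i -> x \in V.
  by move=> VP /in_adjoin[|[->]] //; rewrite eqxx.
have ar2 V x : V \in P2 -> x \in adjoin V -> ~~ (i < x < l)%N.
  move=> VP /in_adjoin[/(r2 _ _ VP)/andP[lx _]|[-> _]]; last by rewrite ltnn.
  by rewrite [(x < l)%N]ltnNge lx andbF.
have in2 V : V \in P2 -> i \notin V.
  by move=> VP; apply/negP => /(r2 _ _ VP); rewrite leqNgt il.
have gP W : W \in glue (P1, P2) ->
    W \in P1 \/ exists2 V, V \in P2 & W = adjoin V.
  by case/setUP=> [|/imsetP[V VP ->]]; [left | right; exists V].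
have g1 V : V \in P1 -> V \in glue (P1, P2) by move=> VP; rewrite inE VP.
have g2 V : V \in P2 -> adjoin V \in glue (P1, P2).
  by move=> VP; rewrite inE imset_f ?orbT.
have nz2 V : V \in P2 -> exists x, x \in V.
  move=> VP; apply/set0Pn; apply: contra n2 => /eqP <- //.
have nsub V : V \in P2 -> ~~ (adjoin V \subset itv i.+1 l).
  move=> VP; have [x xV] := nz2 V VP; apply/subsetPn; exists x.
    exact: sub_adjoin.
  by rewrite inE; apply: (ar2 V) => //; apply: sub_adjoin.
have [|Vl VlP lVl] := c2 l; first by rewrite inE leqnn.
split; last first.
  congr (_, _).
    apply/setP => W; rewrite inE; apply/andP/idP => [[/gP[//|[V VP ->]]]|WP].
      by rewrite (negPf (nsub V VP)).
    by rewrite g1 // s1.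
  apply/setP => W; apply/imsetP/idP => [[V0]|WP].
    rewrite inE => /andP[/gP[/s1 ->//|[V VP ->] _ ->]].
    rewrite /adjoin; case: ifP => _; first by rewrite setU1K ?in2.
    by rewrite (setDidPl _) // disjoint_sym disjoints1 in2.
  exists (adjoin W); first by rewrite inE g2 ?nsub.
  rewrite /adjoin; case: ifP => _; first by rewrite setU1K ?in2.
  by rewrite (setDidPl _) // disjoint_sym disjoints1 in2.
apply/andP; split; last first.
  apply/(next_ofP _ i_neq_l); split=> //; exists (adjoin Vl).
  have iVl : i \in adjoin Vl by rewrite /adjoin lVl setU11.
  by rewrite g2 // (sub_adjoin lVl) iVl; split=> // y; apply: ar2.
apply/andP; split.
  apply/partitionP; split.
  - move=> W /gP[WP|[V VP ->]]; apply/subsetP => x.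
      move/(r1 _ _ WP) => /andP[ix xl]; rewrite inE (ltnW ix).
      exact: ltn_trans lj.
    case/in_adjoin=> [/(r2 _ _ VP)/andP[lx xj]|[-> _]]; rewrite inE.
      by rewrite xj (leq_trans (ltnW il)).
    by rewrite leqnn (ltn_trans il).
  - move=> x; rewrite inE leq_eqVlt => /andP[/orP[/eqP/val_inj <- _|ix xj]].
      by exists (adjoin Vl); rewrite ?g2 // /adjoin lVl setU11.
    have [xl|lx] := ltnP x l.
      have [|V VP xV] := c1 x; first by rewrite inE ix.
      by exists V; rewrite ?g1.
    have [|V VP xV] := c2 x; first by rewrite inE lx.
    by exists (adjoin V); rewrite ?g2 ?sub_adjoin.
  - move=> V W x /gP[VP|[V' VP ->]] /gP[WP|[W' WP ->]].
    + exact: t1.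
    + by move=> /(r1 _ _ VP) xV /(ar2 _ _ WP); rewrite xV.
    + by move=> /(ar2 _ _ VP) xV /(r1 _ _ WP) xW; rewrite xW in xV.
    + move=> xV xW; congr adjoin; have [xi|xi] := eqVneq x i.
        apply: (t2 _ _ l VP WP).
          by case/in_adjoin: xV => [|[]//]; rewrite xi (negPf (in2 _ VP)).
        by case/in_adjoin: xW => [|[]//]; rewrite xi (negPf (in2 _ WP)).
      by apply: (t2 _ _ x VP WP); apply: ar.
  - apply/negP => /gP[]; first by rewrite (negPf n1).
    case=> V VP e0; have [x xV] := nz2 V VP.
    by have := sub_adjoin xV; rewrite -e0 inE.
apply/noncrossingP => V W a b c d /gP[VP|[V' VP ->]] /gP[WP|[W' WP ->]] ab bc cd.
- exact: nc1 cd.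
- move=> /(r1 _ _ VP)/andP[ia _] /(r1 _ _ VP)/andP[_ cl] /(ar2 _ _ WP).
  by rewrite (ltn_trans ia ab) (ltn_trans bc cl).
- move=> _ /(ar2 _ _ VP) + /(r1 _ _ WP)/andP[ib _] /(r1 _ _ WP)/andP[_ dl].
  by rewrite (ltn_trans ib bc) (ltn_trans cd dl).
move=> aV cV bW dW.
have gei x U : U \in P2 -> x \in adjoin U -> (i <= x)%N.
  move=> UP /in_adjoin[/(r2 _ _ UP)/andP[lx _]|[->]] //.
  by rewrite (leq_trans (ltnW il)).
have ai := gei _ _ VP aV; have bi := leq_ltn_trans ai ab.
have neqi x : (i < x)%N -> x != i by apply: contraTneq => ->; rewrite ltnn.
have {}bW := ar _ _ WP bW (neqi b bi).
have {}cV := ar _ _ VP cV (neqi c (ltn_trans bi bc)).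
have {}dW := ar _ _ WP dW (neqi d (ltn_trans bi (ltn_trans bc cd))).
(* If the smallest of the four points is the adjoined [i], then [l] takes its place; when [l = b],
   the two blocks share a point and coincide for that reason. *)
congr adjoin; case/in_adjoin: aV => [aV|[_ lV]].
  exact: (nc2 V' W' a b c d).
have /andP[lb _] := r2 _ _ WP bW.
have [lb'|bl] := ltnP l b; first exact: (nc2 V' W' l b c d).
apply: (t2 V' W' l VP WP) => //.
by have -> : l = b by apply/val_inj/anti_leq; rewrite lb bl.
Qed.


Lemma cutK P : ncp (itv i j) P && next_of i P l ->
  (ncp (itv i.+1 l) (cut P).1 && ncp (itv l j) (cut P).2)
  /\ glue (cut P) = P.
Proof.
case/andP=> /andP[/partitionP[sP cP tP nP] /noncrossingP nc].
case/(next_ofP _ i_neq_l) => _ [V [VP iV lV nV]].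
have rP W x : W \in P -> x \in W -> (i <= x < j)%N.
  by move=> WP /(subsetP (sP W WP)); rewrite inE.
have Vi W : W \in P -> i \in W -> W = V by move=> WP iW; apply: tP iV.
have Vl W : W \in P -> l \in W -> W = V by move=> WP lW; apply: tP lV.
(* Suppose [x] lay in the gap. Then [W] differs from [V], so its point [z] outside the gap lies
   beyond [l], and [i < x < l < z] is a crossing of [V] and [W]. *)
have out W x : W \in P -> ~~ (W \subset itv i.+1 l) -> x \in W -> x != i ->
    (l <= x < j)%N.
  move=> WP /subsetPn[z zW]; rewrite inE negb_and -!leqNgt => zout xW xi.
  have /andP[ix ->] := rP _ _ WP xW; rewrite andbT leqNgt; apply/negP => xl.
  have {}ix : (i < x)%N by rewrite ltn_neqAle ix eq_sym xi.
  have WV : W != V by apply/eqP => eWV; move: (nV x); rewrite -eWV xW ix xl; auto.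
  have zi : z != i by apply: contraNneq WV => ezi; rewrite (Vi W) // -ezi.
  have zl : z != l by apply: contraNneq WV => ezl; rewrite (Vl W) // -ezl.
  case/andP: (rP _ _ WP zW) => iz _; case/orP: zout => [zi'|lz].
    by case/eqP: zi; apply/val_inj/anti_leq; rewrite zi' iz.
  case/eqP: WV; apply/esym; apply: (nc V W i x l z) => //.
  by rewrite ltn_neqAle lz eq_sym zl.
have adjK W : W \in P -> adjoin (W :\ i) = W.
  move=> WP; rewrite /adjoin; case: ifP => [|/negbT].
    by rewrite !inE => /andP[_ /(Vl _ WP) ->]; rewrite setD1K.
  rewrite !inE negb_and negbK eq_sym (negPf i_neq_l) /= => lW.
  rewrite (setDidPl _) // disjoint_sym disjoints1.
  by apply: contra lW => /(Vi _ WP) ->.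
split; last first.
  apply/setP => W; apply/setUP/idP.
    case=> [|/imsetP[W' /imsetP[U + ->] ->]]; rewrite inE => /andP[//].
    by move=> UP _; rewrite adjK.
  move=> WP; have [WG|WG] := boolP (W \subset itv i.+1 l).
    by left; rewrite inE WP.
  right; apply/imsetP; exists (W :\ i); last by rewrite adjK.
  by apply/imsetP; exists W; rewrite // inE WP.
apply/andP; split; apply/andP; split.
- apply/partitionP; split=> [W|x|W U x|]; rewrite ?inE.
  + by case/andP.
  + case/andP=> ix xl; have [|W WP xW] := cP x.
      by rewrite inE (ltnW ix) (ltn_trans xl lj).
    exists W => //; rewrite inE WP; apply: contraTT xl => WG; rewrite -leqNgt.
    have xi : x != i by apply: contraTneq ix => ->; rewrite ltnn.
    by have /andP[] := out _ _ WP WG xW xi.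
  + by move=> /andP[WP _] /andP[UP _]; apply: tP.
  + by rewrite (negPf nP).
- apply/noncrossingP => W U a b c d; rewrite !inE => /andP[WP _] /andP[UP _].
  exact: nc.
- apply/partitionP; split=> [W|x|W U x|].
  + case/imsetP=> U; rewrite inE => /andP[UP UG] ->; apply/subsetP => x.
    by rewrite !inE => /andP[xi xU]; apply: (out U).
  + rewrite inE => /andP[lx xj]; have ix := leq_trans il lx.
    have [|W WP xW] := cP x; first by rewrite inE (ltnW ix) xj.
    exists (W :\ i).
      apply/imsetP; exists W; rewrite // inE WP; apply/subsetPn; exists x => //.
      by rewrite inE [(x < l)%N]ltnNge lx andbF.
    rewrite !inE xW andbT; apply: contraTneq ix => ->.
    by rewrite ltnn.
  + case/imsetP=> W'; rewrite inE => /andP[WP _] ->.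
    case/imsetP=> U'; rewrite inE => /andP[UP _] ->.
    by rewrite !inE => /andP[_ xW] /andP[_ xU]; rewrite (tP W' U' x).
  + apply/imsetP => -[W]; rewrite inE => /andP[WP _] e0.
    have /set0Pn[x xW] : W != set0 by apply: contra nP => /eqP <-.
    have xi : x = i.
      by apply/eqP; apply: contraTT xW => xi; move/setP/(_ x): e0;
         rewrite !inE xi /= => <-.
    move/setP/(_ l): e0; rewrite (Vi W) // -?xi // !inE lV andbT.
    by rewrite xi eq_sym i_neq_l.
apply/noncrossingP => W U a b c d.
case/imsetP=> W'; rewrite inE => /andP[WP _] ->.
case/imsetP=> U'; rewrite inE => /andP[UP _] -> ab bc cd.
rewrite !inE => /andP[_ aW] /andP[_ cW] /andP[_ bU] /andP[_ dU].
by rewrite (nc W' U' a b c d).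
Qed.

(** Merging [i] into [l] hands over its multiplicity: [l] then stands for the [r.+1] points of [i]
    and for itself. *)
Lemma nc_sum_next :
  \sum_(P | ncp (itv i j) P && next_of i P l) \prod_(V in P) wt r i V
  = nc_sum (itv i.+1 l) * nc_sum_at r.+1 l (itv l j).
Proof.
rewrite (@sum_bij _ _ glue cut _ (fun Ps =>
  ncp (itv i.+1 l) Ps.1 && ncp (itv l j) Ps.2)); first last.
- by move=> [P1 P2] /andP[] /=; apply: glueK.
- exact: cutK.
rewrite /nc_sum /nc_sum_at big_distrlr /= pair_big /=.
apply: eq_bigr => -[P1 P2] /= /andP[/andP[/partitionP[s1 _ _ _] _]].
move=> /andP[/partitionP[s2 _ _ n2] _].
have i1 V : V \in P1 -> i \notin V.
  by move=> VP; apply/negP => /(subsetP (s1 V VP)); rewrite inE ltnn.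
have i2 V : V \in P2 -> i \notin V.
  by move=> VP; apply/negP => /(subsetP (s2 V VP)); rewrite inE leqNgt il.
have adjK V : V \in P2 -> adjoin V :\ i = V.
  rewrite /adjoin => VP; case: ifP => _; first by rewrite setU1K ?i2.
  by rewrite (setDidPl _) // disjoint_sym disjoints1 i2.
rewrite (eq_bigl (mem [predU P1 & adjoin @: P2])); last by move=> V; rewrite !inE.
rewrite bigU /=; last first.
  apply/pred0Pn => -[W /andP[/= WP /imsetP[V VP eW]]].
  have /set0Pn[x xV] : V != set0 by apply: contra n2 => /eqP <-.
  have := subsetP (s1 W WP) x; rewrite eW sub_adjoin // => /(_ isT).
  have := subsetP (s2 V VP) x xV; rewrite !inE => /andP[lx _] /andP[_].
  by rewrite ltnNge lx.
congr (_ * _).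
  by apply: eq_bigr => V VP; rewrite /wt (negPf (i1 V VP)) addn0.
rewrite big_imset /=; last first.
  by move=> V W VP WP eVW; rewrite -(adjK V VP) eVW adjK.
apply: eq_bigr => V VP; rewrite /wt /adjoin; case: ifP => lV.
  by rewrite cardsU1 i2 // setU11 !mul1n add1n addSnnS.
by rewrite (negPf (i2 V VP)).
Qed.

End Split.

Lemma nc_sum_at_rec r (i : 'I_p) (j : nat) : (i < j)%N ->
  nc_sum_at r i (itv i j) = k r.+1 * nc_sum (itv i.+1 j)
    + \sum_(l : 'I_p | (i < l < j)%N)
        nc_sum (itv i.+1 l) * nc_sum_at r.+1 l (itv l j).
Proof.
move=> ij; transitivity (\sum_(P | ncp (itv i j) P)
    \sum_(l | next_of i P l) \prod_(V in P) wt r i V).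
  apply: eq_bigr => P /andP[/(next_of_unique ij)[l _ nl] _].
  by rewrite (big_pred1 l).
rewrite (exchange_big_dep (fun l : 'I_p => (i <= l < j)%N)) /=; last first.
  move=> P l /andP[/(next_of_unique ij)[l0 l0ij nl] _].
  by rewrite nl => /eqP ->.
rewrite (bigD1 i) /= ?leqnn //; congr (_ + _).
  by rewrite -nc_sum_singleton //; apply: eq_bigl => P; rewrite /next_of eqxx.
apply: eq_big => [l|l]; first by
  rewrite andbAC; congr (_ && _); rewrite ltn_neqAle andbC eq_sym.
by case/andP=> /andP[il lj] li; rewrite nc_sum_next // ltn_neqAle il eq_sym li.
Qed.

Variable N : nat.
Hypothesis pN : (p <= N)%N.

(** A point worth [r.+1] points whose block has [s] more points to come is an up-step by [s], and
    the gap before the next of these points is the excursion before the first descent. Thus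
    [nc_sum_at_rec] mirrors [path_sum_cut]. The two claims are proved together because each one
    calls the other. *)
Lemma nc_sum_path q :
  (forall i j : nat, (i <= j <= p)%N -> (j - i = q)%N ->
     nc_sum (itv i j) = path_sum k N q 0) /\
  (forall r (i : 'I_p) (j : nat), (i < j <= p)%N -> (j - i = q.+1)%N ->
     nc_sum_at r i (itv i j) = \sum_(s < N) k (s + r).+1 * path_sum k N q s).
Proof.
elim/ltn_ind: q => q IH.
have HM (i j : nat) : (i <= j <= p)%N -> (j - i = q)%N ->
     nc_sum (itv i j) = path_sum k N q 0.
  case/andP; rewrite leq_eqVlt => /orP[/eqP <- _ <-|ij jp jiq].
    rewrite subnn path_sum0 eqxx -nc_sum0; congr nc_sum; apply/setP => x.
    by rewrite !inE; case: leqP => // /ltnW; rewrite leqNgt => /negPf.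
  have q0 : (0 < q)%N by rewrite -jiq subn_gt0.
  rewrite -(nc_sum_at0 (Ordinal (leq_trans ij jp))).
  case: q IH jiq q0 => // q IH jiq _.
  rewrite (IH q _).2 ?ij //= path_sumS addr0.
  by apply: eq_bigr => s _; rewrite addn0 add0n.
split=> // r i j /andP[ij jp] jiq.
have iq : (j = i.+1 + q)%N by rewrite addSnnS -jiq subnKC // ltnW.
rewrite nc_sum_at_rec // HM ?ij //; last by rewrite iq addKn.
rewrite (eq_bigr (fun l : 'I_p => path_sum k N (l - i.+1) 0 *
    \sum_(s < N) k (s + r.+1).+1 * path_sum k N (j - l.+1) s)); last first.
  move=> l /andP[il lj]; congr (_ * _).
    rewrite (IH (l - i.+1)%N _).1 ?il ?(ltnW (ltn_ord l)) //.
    by rewrite ltn_subLR // -iq.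
  rewrite (IH (j - l.+1)%N _).2 ?lj //; last by rewrite subnSK.
  by lia.
set f := path_sum k N.
have [N' eN] : exists N', N = N'.+1 by exists N.-1; lia.
rewrite -(big_mkord (fun l => (i < l < j)%N) (fun l => f (l - i.+1)%N 0%N *
  \sum_(s < N) k (s + r.+1).+1 * f (j - l.+1)%N s)).
under eq_bigl do rewrite andbC.
rewrite -(big_nat_widenl _ _ _ (fun l => (l < j)%N)) //.
rewrite -(big_nat_widen _ _ _ xpredT) // -{1}[i.+1]add0n big_addn.
have -> : (j - i.+1 = q)%N by lia.
(* The term [s = 0] is a block without further points. The other paths are cut at the first descent,
   [t] being the number of points between [i] and [l]. *)
rewrite big_mkord eN big_ord_recl add0n addrC [in RHS]addrC; congr (_ + _).
under [RHS]eq_bigr => s _.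
  rewrite lift0 -[s : nat]add0n /f path_sum_cut -/f add0n mulr_sumr.
over.
rewrite exchange_big /=; apply: eq_bigr => t _; have tq := ltn_ord t.
(* After the shift of [s] the last term has no counterpart, but its height [N'] exceeds the number
   of steps left. *)
rewrite addnK big_ord_recr /= [f _ N']path_sum_gt ?mulr0 ?addr0; last by lia.
rewrite mulr_sumr; apply: eq_bigr => s _.
have -> : (j - (t + i.+1).+1 = q - t.+1)%N by lia.
by rewrite mulrCA addSnnS.
Qed.

Lemma nc_sumT : nc_sum [set: 'I_p] = path_sum k N p 0.
Proof.
rewrite -((nc_sum_path p).1 0%N p) ?subn0 ?leqnn //; congr nc_sum; apply/setP => x.
by rewrite !inE ltn_ord.
Qed.

End NCRec.

(** * Moments and cumulants of a single element *)

Lemma kappa_pi_nseq (B : zmodType) (C : numClosedFieldType) (kappa : seq B -> C)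
    (y : B) p (P : {set {set 'I_(size (nseq p y))}}) :
  kappa_pi kappa P = \prod_(V in P) kappa (nseq #|V| y).
Proof.
apply: eq_bigr => V _; congr kappa; rewrite cardE.
rewrite -(size_map (fun i : 'I__ => nth 0 (nseq p y) (val i))).
apply/all_pred1P/allP => _ /mapP[i _ ->] /=.
by have := ltn_ord i; rewrite [X in (_ < X)%N]size_nseq nth_nseq => ->.
Qed.

Lemma moment_nc_sum (C : numClosedFieldType) (B : zmodType)
    (scale : C -> B -> B) (mul : B -> B -> B) (one : B) (S : pred B)
    (phi : B -> C) (kappa : seq B -> C) (y : B) (p : nat) :
  free_cumulants scale mul one S phi kappa -> S y -> (0 < p)%N ->
  phi (foldr mul one (nseq p y))
  = nc_sum (fun r => kappa (nseq r y)) [set: 'I_p].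
Proof.
move=> [_ mc] Sy p0; rewrite mc ?size_nseq //; last by rewrite all_nseq Sy orbT.
rewrite (eq_bigr _ (fun P _ => kappa_pi_nseq kappa P)) /nc_sum /ncp /NCpart.
(* Generalising the size turns the ordinals below [size (nseq p y)] into ['I_p] without a cast. *)
by move: (size_nseq p y); move: (size _) => m ->.
Qed.

(** The one-block partition contributes [k p], and every other partition has only blocks of fewer
    than [p] points, for which the induction hypothesis applies. *)
Lemma nc_sum_inj (R : comNzRingType) (k k' : nat -> R) :
  (forall p, (0 < p)%N -> nc_sum k [set: 'I_p] = nc_sum k' [set: 'I_p]) ->
  forall p, (0 < p)%N -> k p = k' p.
Proof.
move=> eqk; elim/ltn_ind => p IH p0; have := eqk p p0.
have ncT : ncp [set: 'I_p] [set [set: 'I_p]].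
  apply/andP; split.
    apply/partitionP; split=> [V|x _|V W x|]; rewrite ?inE //.
    - by exists setT; rewrite ?inE.
    - by move=> /eqP -> /eqP ->.
    - rewrite eq_sym -cards_eq0 cardsT card_ord -lt0n //.
  by apply/noncrossingP => V W a b c d; rewrite !inE => /eqP-> /eqP->.
have topD (f : nat -> R) : nc_sum f [set: 'I_p] = f p
    + \sum_(P | ncp [set: 'I_p] P && (P != [set [set: 'I_p]]))
        \prod_(V in P) f #|V|.
  by rewrite /nc_sum (bigD1 [set [set: 'I_p]]) //= big_set1 cardsT card_ord.
rewrite !topD; suff <- : \sum_(P | ncp [set: 'I_p] P && (P != [set setT]))
    \prod_(V in P) k #|V| = \sum_(P | ncp [set: 'I_p] P && (P != [set setT]))
    \prod_(V in P) k' #|V| by move/addIr.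
apply: eq_bigr.
move=> P /andP[/andP[/partitionP[_ _ tP P0] _] PT]; apply: eq_bigr => V VP.
have /set0Pn[x xV] : V != set0 by apply: contra P0 => /eqP <-.
apply: IH; last by apply/card_gt0P; exists x.
rewrite -[X in (_ < X)%N](card_ord p) -cardsT proper_card // properT.
apply: contra PT => /eqP VT; apply/eqP/setP => W; rewrite inE.
apply/idP/eqP => [WP|->]; last by rewrite -VT.
have /set0Pn[z zW] : W != set0 by apply: contra P0 => /eqP <-.
by rewrite -VT (tP W V z) // VT inE.
Qed.

(** * The Fock space model of freeness *)

Section Fock.
Variables (C : numClosedFieldType) (n : nat) (k : nat -> C) (N : nat).
Implicit Types (d t : 'M[C]_n) (g f : seq 'M[C]_n -> C) (p q : {poly C}).
Local Notation funext := functional_extensionality.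

Definition ntr d : C := n%:R^-1 * \tr d.

(* Dual picture: a word acts on the functionals of stacks, its first letter
   last.  The empty stack only arises from popping the bottom. *)
Definition opX g st : C :=
  if st is t :: rest then
    \sum_(s < N) k s.+1 * g (nseq s 1%:M ++ st) + ntr t * g rest
  else 0.

Definition opM d g st : C := if st is t :: rest then g (t *m d :: rest) else 0.

Definition opP p g st : C := \sum_(i < size p) p`_i * iter i opX g st.

Definition vac (st : seq 'M[C]_n) : C := if st is [:: t] then ntr t else 0.

(** With whole polynomials and whole matrices as letters, centring a letter or multiplying two
    neighbours of the same kind gives a letter again. *)
Definition letter := ({poly C} + 'M[C]_n)%type.

Definition op1 (a : letter) g : seq 'M[C]_n -> C :=
  match a with inl p => opP p g | inr d => opM d g end.

Definition op (w : seq letter) g : seq 'M[C]_n -> C := foldr op1 g w.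

Definition comb (c : C) g f : seq 'M[C]_n -> C := fun st => c * g st + f st.

Lemma opX_comb c g f : opX (comb c g f) = comb c (opX g) (opX f).
Proof.
apply: funext => -[|t st]; rewrite /comb /= ?mulr0 ?addr0 // !mulrDr addrACA.
congr (_ + _); last by rewrite mulrCA.
by rewrite mulr_sumr -big_split; apply: eq_bigr => s _; rewrite mulrDr mulrCA.
Qed.

Lemma opM_comb d c g f : opM d (comb c g f) = comb c (opM d g) (opM d f).
Proof. by apply: funext => -[|t st]; rewrite /comb /= ?mulr0 ?addr0. Qed.

Lemma iter_opX_comb i c g f :
  iter i opX (comb c g f) = comb c (iter i opX g) (iter i opX f).
Proof. by elim: i => //= i ->; rewrite opX_comb. Qed.

Lemma opP_comb p c g f : opP p (comb c g f) = comb c (opP p g) (opP p f).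
Proof.
apply: funext => st; rewrite /comb /opP mulr_sumr -big_split.
apply: eq_bigr => i _; rewrite -[fun st => _]/(comb c g f) iter_opX_comb /comb.
by rewrite mulrDr mulrCA.
Qed.

Lemma op_comb w c g f : op w (comb c g f) = comb c (op w g) (op w f).
Proof. by elim: w => //= -[p|d] w ->; rewrite /= ?opP_comb ?opM_comb. Qed.

Lemma opP_widen m p g st : (size p <= m)%N ->
  opP p g st = \sum_(i < m) p`_i * iter i opX g st.
Proof.
move=> pm; rewrite /opP (big_ord_widen m (fun i => p`_i * iter i opX g st)) //.
rewrite big_mkcond; apply: eq_bigr => i _; case: ltnP => // pi.
by rewrite nth_default // mul0r.
Qed.

Lemma opP_lin c p q g : opP (c *: p + q) g = comb c (opP p g) (opP q g).
Proof.
apply: funext => st; pose m := maxn (size (c *: p + q)) (maxn (size p) (size q)).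
rewrite /comb !(@opP_widen m) ?leq_maxr ?leq_maxl //; last first.
  by rewrite /m !leq_max leqnn !orbT.
- by rewrite /m !leq_max leqnn !orbT.
rewrite mulr_sumr -big_split; apply: eq_bigr => i _.
by rewrite coefD coefZ mulrDl mulrA.
Qed.

Lemma opPC c g st : opP c%:P g st = c * g st.
Proof.
by rewrite (@opP_widen 1) ?size_polyC_leq1 // big_ord1 coefC eqxx.
Qed.

Lemma opPMX p g : opP (p * 'X) g = opP p (opX g).
Proof.
apply: funext => st; rewrite (@opP_widen (size p).+1); last first.
  by have [->|p0] := eqVneq p 0; rewrite ?mul0r ?size_poly0 // size_mulX.
rewrite big_ord_recl coefMX mul0r add0r; apply: eq_bigr => i _.
by rewrite lift0 coefMX -iterSr.
Qed.

Lemma opPMXaddC p c g : opP (p * 'X + c%:P) g = comb c g (opP p (opX g)).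
Proof.
rewrite addrC -[c%:P]mulr1 mul_polyC opP_lin opPMX; congr comb.
by apply: funext => st; rewrite opPC mul1r.
Qed.

Lemma opXP q g : opX (opP q g) = opP q (opX g).
Proof.
elim/poly_ind: q g => [|q c IH] g.
  apply: funext => -[|t st]; rewrite /= /opP !size_poly0 !big_ord0 //.
  by rewrite mulr0 addr0 big1 // => s _; rewrite big_ord0 mulr0.
by rewrite !opPMXaddC opX_comb IH.
Qed.

(** Both sides are built from [opX], which commutes with every [opP q]; Horner induction on [p] does
    the rest. This allows neighbouring polynomial letters to be merged. *)
Lemma opPM p q g : opP (p * q) g = opP p (opP q g).
Proof.
elim/poly_ind: p g => [|p c IH] g.
  by rewrite mul0r; apply: funext => st; rewrite /opP !size_poly0 !big_ord0.
rewrite opPMXaddC mulrDl addrC mul_polyC opP_lin; congr comb.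
by rewrite mulrAC opPMX IH opXP.
Qed.

(** Centring a matrix letter changes one entry of the stack by a multiple of another; linearity in
    each entry splits the value accordingly. *)
Definition stack_multilinear g :=
  forall s1 s2 c u v,
    g (s1 ++ c *: u + v :: s2) = c * g (s1 ++ u :: s2) + g (s1 ++ v :: s2).

Lemma ntr_lin c d t : ntr (c *: d + t) = c * ntr d + ntr t.
Proof. by rewrite /ntr linearP /= mulrDr mulrCA. Qed.

Lemma vac_multilinear : stack_multilinear vac.
Proof.
by move=> [|a [|b s1]] [|e s2] c u v; rewrite /= ?ntr_lin ?mulr0 ?addr0.
Qed.

Lemma opX_multilinear g : stack_multilinear g -> stack_multilinear (opX g).
Proof.
move=> gl [|t s1] s2 c u v /=; rewrite [c * (_ + _)]mulrDr addrACA mulr_sumr -big_split /=.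
  congr (_ + _); last by rewrite ntr_lin mulrDl mulrA.
  by apply: eq_bigr => s _; rewrite gl mulrDr mulrCA.
congr (_ + _); last by rewrite gl mulrDr mulrCA.
by apply: eq_bigr => s _; rewrite -!cat_cons !catA gl mulrDr mulrCA.
Qed.

Lemma opM_multilinear d g : stack_multilinear g -> stack_multilinear (opM d g).
Proof.
move=> gl [|t s1] s2 c u v /=; last by rewrite -cat_cons gl.
by rewrite mulmxDl -scalemxAl -[_ :: s2]cat0s gl.
Qed.

Lemma opP_multilinear p g : stack_multilinear g -> stack_multilinear (opP p g).
Proof.
move=> gl s1 s2 c u v; rewrite /opP mulr_sumr -big_split; apply: eq_bigr => i _.
have il : stack_multilinear (iter i opX g).
  by elim: (i : nat) => //= j; apply: opX_multilinear.
by rewrite il mulrDr mulrCA.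
Qed.

Lemma op_multilinear w : stack_multilinear (op w vac).
Proof.
elim: w => [|[p|d] w IH] /=; first exact: vac_multilinear.
  exact: opP_multilinear.
exact: opM_multilinear.
Qed.

(** [vac] vanishes at the empty stack and every letter preserves this, so that popping the bottom
    entry contributes nothing. *)
Lemma op_nil w : op w vac [::] = 0.
Proof.
elim: w => //= -[p|d] w IH //=; rewrite /opP big1 // => -[[|i] ?] _ /=.
  by rewrite IH mulr0.
by rewrite mulr0.
Qed.

End Fock.

Lemma natC_neq0 (C : numClosedFieldType) (n : nat) :
  (0 < n)%N -> n%:R != 0 :> C.
Proof. by rewrite pnatr_eq0 -lt0n. Qed.

(** * Summation over the indices *)

Section Chain.
Variables (C : numClosedFieldType) (n : nat) (k : nat -> C) (N : nat).
Hypothesis n_gt0 : (0 < n)%N.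
Variables (i1 o : 'I_n).
Implicit Types (a b c u v : 'I_n) (r : seq (option ('I_n * 'I_n))).

Let n_neq0 : n%:R != 0 :> C := natC_neq0 C n_gt0.

Lemma multilinearZ (g : seq 'M[C]_n -> C) (c : C) d st :
  stack_multilinear g -> g (c *: d :: st) = c * g (d :: st).
Proof.
move=> gl; have g0 : g (0 :: st) = 0.
  have := gl [::] st 1 0 0; rewrite scale1r addr0 mul1r => /esym/eqP.
  by rewrite -subr_eq0 addrK => /eqP.
by have := gl [::] st c d 0; rewrite addr0 /= g0 addr0.
Qed.

Lemma ntr_delta u b : ntr (delta_mx u b : 'M[C]_n) = (u == b)%:R / n%:R.
Proof.
rewrite /ntr /mxtrace (bigD1 u) //= big1 ?addr0.
  by rewrite mxE eqxx mulrC.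
by move=> i iu; rewrite mxE (negPf iu).
Qed.

(* [x e_{a c} x e_{b d} ...] with [q] letters [x], summed over all index sequences
   which start with the pair [(a, b)] and end with the pair [(i1, o)]. *)
Fixpoint chain (q : nat) a b : seq 'M[C]_n -> C :=
  if q is q'.+1 then
    fun st => \sum_c opX k N (opM (delta_mx a c) (chain q' b c)) st
  else comb ((a == i1) && (b == o))%:R (@vac C n) (fun=> 0).

Lemma chain_multilinear q a b : stack_multilinear (chain q a b).
Proof.
elim: q a b => [|q IH] a b s1 s2 c u v /=.
  by rewrite /comb vac_multilinear !addr0 mulrDr mulrCA.
rewrite mulr_sumr -big_split; apply: eq_bigr => j _.
by apply: opX_multilinear; apply: opM_multilinear; apply: IH.
Qed.

Lemma chainZ q a b (c : C) d st :
  chain q a b (c *: d :: st) = c * chain q a b (d :: st).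
Proof. by rewrite multilinearZ //; apply: chain_multilinear. Qed.

(* The value of a stack once all its entries are popped.  [None] stands for the
   identity matrix, [Some (u, v)] for [e_{u v}]; the current pair of indices is
   [(a, b)] and the top of the stack is [e_{u b}], [b] being summed over. *)
Fixpoint contraction r a u : C :=
  match r with
  | [::] => ((a == i1) && (u == o))%:R / n%:R
  | None :: r' => contraction r' u a / n%:R
  | Some (u', v') :: r' => (v' == a)%:R * contraction r' u u' / n%:R
  end.

Definition stack_of r : seq 'M[C]_n :=
  map (fun m => if m is Some (u, v) then delta_mx u v else 1%:M) r.

(** The cumulant claimed for the partial transpose, with the scalar of [x / n] already taken out by
    homogeneity. *)
Definition weight (s : nat) : C :=
  (if odd s then n%:R else n%:R ^+ 2) * (k s / n%:R ^+ s).

(** Popping an identity swaps the two current indices, so only the parity of [s] matters when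
    [e_{u b}] is reached. *)
Lemma contraction_block s u b r a' u' :
  contraction (nseq s None ++ Some (u, b) :: r) a' u'
  = n%:R ^- s.+1 * (if odd s then (b == u')%:R * contraction r a' u
                    else (b == a')%:R * contraction r u' u).
Proof.
elim: s a' u' => [|s IH] a' u' /=; first by rewrite expr1 mulrC.
by rewrite IH mulrC mulrA -invfM -exprS; case: odd.
Qed.

Let n_pow_neq0 s : n%:R ^+ s != 0 :> C.
Proof. by rewrite expf_neq0. Qed.

(** A whole block is closed here. For odd [s] a Kronecker delta fixes [b]; for even [s] the sum over
    [b] is free and yields a further factor [n]. *)
Lemma sum_contraction s u r a :
  k s.+2 * \sum_b contraction (nseq s None ++ Some (u, b) :: r) b a
  = weight s.+2 * contraction r a u.
Proof.
under eq_bigr do rewrite contraction_block.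
rewrite -mulr_sumr /weight /= negbK !exprS.
case: odd.
  rewrite (bigD1 a) //= big1 ?addr0 => [|b ba]; last by rewrite (negPf ba) mul0r.
  by rewrite eqxx mul1r; field; rewrite ?n_neq0 ?n_pow_neq0.
under eq_bigr do rewrite eqxx mul1r.
rewrite sumr_const card_ord -[contraction _ _ _ *+ _]mulr_natl.
by field; rewrite n_neq0 n_pow_neq0.
Qed.

(** Induction on the number of letters [x]: the first one pushes or pops, as a path steps up or
    down. Keeping the sum over [b] in the statement is what allows [sum_contraction] to turn each
    [k s] into [weight s]. *)
Lemma sum_chain q a u r :
  \sum_b chain q a b (delta_mx u b :: stack_of r)
  = path_sum weight N q (size r) * contraction r a u.
Proof.
elim: q a u r => [|q IH] a u r /=.
  rewrite path_sum0 /comb; case: r => [|m r] /=; last first.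
    by rewrite mul0r big1 // => b _; rewrite mulr0 addr0.
  rewrite (bigD1 o) //= big1 ?addr0; last first.
    by move=> b bo; rewrite (negPf bo) andbF mul0r addr0.
  by rewrite ntr_delta eqxx andbT mul1r; case: (a == i1); rewrite ?mul1r ?mul0r.
rewrite path_sumS mulrDl.
under eq_bigr do rewrite big_split.
rewrite big_split /=; congr (_ + _).
  under eq_bigr do rewrite exchange_big.
  rewrite exchange_big mulr_suml; apply: eq_bigr => -[s sN] _ /=.
  under eq_bigr do rewrite -mulr_sumr.
  rewrite -mulr_sumr; case: s {sN} => [|s] /=.
    (* Nothing is pushed: the product of [e_{u b}] and [e_{a c}] forces [b = a], and [weight 1] is
       [k 1]. *)
    under eq_bigr => b _ do under eq_bigr => c _ do
      rewrite mul_delta_mx_cond -scaler_nat chainZ.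
    under eq_bigr => b _ do rewrite -mulr_sumr.
    rewrite (bigD1 a) //= [X in _ + X]big1 ?addr0 => [|b ba]; last first.
      by rewrite (negPf ba) mul0r.
    rewrite eqxx mul1r IH addn0 [in RHS]/weight /= expr1.
    by field.
  (* Otherwise the top identity becomes [e_{a c}], with [s] identities and then [e_{u b}] below it,
     and [(b, c)] is the new pair. *)
  under eq_bigr => b _ do under eq_bigr => c _ do rewrite mul1mx.
  have E b : nseq s 1%:M ++ delta_mx u b :: stack_of r
      = stack_of (nseq s None ++ Some (u, b) :: r).
    by rewrite /stack_of map_cat map_nseq.
  under eq_bigr => b _ do
    (under eq_bigr => c _ do rewrite E; rewrite IH size_cat size_nseq addnC /=).
  rewrite -mulr_sumr mulrCA sum_contraction /=.
  by rewrite addSnnS mulrCA mulrA.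
(* Popping [e_{u b}] gives its trace, which forces [b = u]; the entry below is then multiplied by
   [e_{a c}]. *)
rewrite (bigD1 u) //= [X in _ + X]big1 ?addr0 => [|b bu]; last first.
  by rewrite big1 // => c _; rewrite ntr_delta eq_sym (negPf bu) !mul0r.
rewrite -mulr_sumr ntr_delta eqxx; case: r => [|[[u' v']|] r] /=.
- by rewrite big1 ?mulr0 ?mul0r.
- under eq_bigr => c _ do
    rewrite mul_delta_mx_cond -scaler_nat chainZ.
  by rewrite -mulr_sumr IH; field.
by under eq_bigr => c _ do rewrite mul1mx; rewrite IH; field.
Qed.

End Chain.

(** * Mixed moments *)

Section FockMoments.
Variables (C : numClosedFieldType) (n : nat) (k : nat -> C) (N : nat).
Hypothesis n_gt0 : (0 < n)%N.
Implicit Types (d t : 'M[C]_n) (g : seq 'M[C]_n -> C) (p : {poly C}).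

Lemma ntr1 : ntr (1%:M : 'M[C]_n) = 1.
Proof. by rewrite /ntr mxtrace1 mulVf // natC_neq0. Qed.

(** Identities have trace 1, so above [d] only the height counts and [opX] acts as a path step. The
    two hypotheses make the pop of [d] itself vanish. *)
Lemma iter_opX_ones g d rest i h :
    g [::] = 0 -> ntr d = 0 \/ rest = [::] ->
  iter i (opX k N) g (nseq h 1%:M ++ d :: rest)
  = iter i (path_step k N) (fun j => g (nseq j 1%:M ++ d :: rest)) h.
Proof.
move=> g0 d0; elim: i h => // i IH h; rewrite !iterS.
move: IH; set G := iter i _ g; set f := iter i _ _ => IH.
have pop0 : ntr d * G rest = 0.
  case: d0 => ->; rewrite ?mul0r // /G.
  by case: (i) => [|i'] /=; rewrite ?g0 mulr0.
case: h => [|h] /=; rewrite /path_step.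
  by rewrite pop0; congr (_ + _); apply: eq_bigr => s _; rewrite IH add0n.
rewrite ntr1 mul1r IH; congr (_ + _); apply: eq_bigr => s _.
by rewrite -[_ :: _ ++ _]/(nseq h.+1 _ ++ _) catA -nseqD IH addnC.
Qed.

(** Only the paths that return to [d] survive, so the polynomial acts as a scalar, namely its mean
    when the moments are the path sums. *)
Lemma opP_bottom p g d rest :
    g [::] = 0 -> ntr d = 0 \/ rest = [::] ->
    (forall j, (0 < j)%N -> g (nseq j 1%:M ++ d :: rest) = 0) ->
  opP k N p g (d :: rest)
  = (\sum_(i < size p) p`_i * path_sum k N i 0) * g (d :: rest).
Proof.
move=> g0 d0 gj; rewrite /opP mulr_suml; apply: eq_bigr => i _.
rewrite -[d :: rest]/(nseq 0 1%:M ++ d :: rest) iter_opX_ones // -mulrA.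
congr (_ * _); rewrite -[in RHS]/(nseq 0 1%:M ++ d :: rest).
have E j h : iter j (path_step k N) (fun j => g (nseq j 1%:M ++ d :: rest)) h
    = path_sum k N j h * g (d :: rest).
  elim: j h => [|j IH] h.
    rewrite path_sum0 /=; case: h => [|h]; first by rewrite mul1r.
    by rewrite gj ?mul0r.
  rewrite iterS path_sumS /path_step mulrDl mulr_suml; congr (_ + _).
    by apply: eq_bigr => s _; rewrite IH mulrA.
  by case: h => [|h]; rewrite ?mul0r ?IH.
exact: E.
Qed.

Definition is_poly (a : letter C n) := if a is inl _ then true else false.

Definition alternating (w : seq (letter C n)) :=
  sorted (fun a b => is_poly a != is_poly b) w.

(** The moments of [x] are known as path sums only up to order [N], so the total degree of a word
    has to be controlled. *)
Definition degree (a : letter C n) : nat :=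
  if a is inl p then (size p).-1 else 0%N.

Section Word.
Variables (A : algType C) (phi : A -> C) (e : 'I_n -> 'I_n -> A) (x : A).
Hypothesis phi_lin :
  forall (c : C) (a b : A), phi (c *: a + b) = c * phi a + phi b.
Hypothesis phi1 : phi 1 = 1.
Hypothesis eM : forall i j k l, e i j * e k l = if j == k then e i l else 0.
Hypothesis e_sum1 : \sum_(i < n) e i i = 1.
Hypothesis phi_e : forall i j, phi (e i j) = (i == j)%:R / n%:R.
Hypothesis free : free_pair phi (alg_gen1 x) (span_units e).
Hypothesis phi_x : forall q, (q <= N)%N -> phi (x ^+ q) = path_sum k N q 0.

Definition ev1 (a : letter C n) : A :=
  match a with
  | inl p => \sum_(i < size p) p`_i *: x ^+ i
  | inr d => \sum_(i < n) \sum_(j < n) d i j *: e i j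
  end.

Definition ev (w : seq (letter C n)) : A := \prod_(a <- w) ev1 a.

Lemma phi0 : phi 0 = 0.
Proof.
have := phi_lin 1 0 0; rewrite scale1r addr0 mul1r => /esym/eqP.
by rewrite -subr_eq0 addrK => /eqP.
Qed.

Lemma phiD a b : phi (a + b) = phi a + phi b.
Proof. by have := phi_lin 1 a b; rewrite scale1r mul1r. Qed.

Lemma phiZ c a : phi (c *: a) = c * phi a.
Proof. by have := phi_lin c a 0; rewrite phi0 !addr0. Qed.

Lemma phi_sum (I : Type) (r : seq I) (P : pred I) (F : I -> A) :
  phi (\sum_(i <- r | P i) F i) = \sum_(i <- r | P i) phi (F i).
Proof. exact: (big_morph phi phiD phi0). Qed.

Lemma ev1_poly p : ev1 (inl p) = horner_alg x p.
Proof.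
rewrite /= /horner_alg /horner_morph horner_coef size_map_poly.
by apply: eq_bigr => i _; rewrite coef_map /= mulr_algl.
Qed.

Lemma ev1_mxM d d' : ev1 (inr (d *m d')) = ev1 (inr d) * ev1 (inr d').
Proof.
rewrite /= mulr_suml; apply: eq_bigr => i _; rewrite mulr_suml.
under [RHS]eq_bigr => j _.
  rewrite mulr_sumr (bigD1 j) //= [X in _ + X]big1 ?addr0; last first.
    move=> l lj; rewrite mulr_sumr big1 // => m _.
    by rewrite -scalerAl -scalerAr eM eq_sym (negPf lj) !scaler0.
  rewrite mulr_sumr.
  under eq_bigr => m _ do rewrite -scalerAl -scalerAr eM eqxx scalerA.
over.
rewrite exchange_big /=; apply: eq_bigr => j _.
by rewrite mxE scaler_suml.
Qed.

Lemma ev1_mx_lin c d d' :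
  ev1 (inr (c *: d + d')) = c *: ev1 (inr d) + ev1 (inr d').
Proof.
rewrite /= scaler_sumr -big_split; apply: eq_bigr => i _.
rewrite scaler_sumr -big_split; apply: eq_bigr => j _.
by rewrite !mxE scalerDl scalerA.
Qed.

Lemma ev1_mx1 : ev1 (inr 1%:M) = 1.
Proof.
rewrite /= -e_sum1; apply: eq_bigr => i _; rewrite (bigD1 i) //= big1.
  by rewrite mxE eqxx scale1r addr0.
by move=> j ji; rewrite mxE eq_sym (negPf ji) scale0r.
Qed.

Lemma phi_mx d : phi (ev1 (inr d)) = ntr d.
Proof.
rewrite /= phi_sum /ntr /mxtrace mulr_sumr; apply: eq_bigr => i _.
rewrite phi_sum (bigD1 i) //= big1.
  by rewrite phiZ phi_e eqxx mul1r mulrC addr0.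
by move=> j ji; rewrite phiZ phi_e eq_sym (negPf ji) mul0r mulr0.
Qed.

Definition center (a : letter C n) : letter C n :=
  match a with
  | inl p => inl (p - (phi (ev1 a))%:P)
  | inr d => inr (d - (phi (ev1 a))%:M)
  end.

Lemma ev1_center a : ev1 (center a) = ev1 a - (phi (ev1 a))%:A.
Proof.
case: a => [p|d] /=.
  rewrite -/(ev1 (inl p)); set c := phi _.
  by rewrite -/(ev1 (inl (p - c%:P))) !ev1_poly linearB /= horner_algC.
rewrite -/(ev1 (inr d)); set c := phi _.
rewrite -/(ev1 (inr (d - c%:M))) addrC -scalemx1 -scaleNr ev1_mx_lin ev1_mx1.
by rewrite addrC scaleNr.
Qed.

Lemma center_mean0 a : phi (ev1 (center a)) = 0.
Proof. by rewrite ev1_center -scaleNr addrC phi_lin phi1 mulr1 addNr. Qed.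

Lemma degree_center a : (degree (center a) <= degree a)%N.
Proof.
case: a => [p|//] /=; set c := phi _.
have sz : (size (p - c%:P)%R <= maxn (size p) 1)%N.
  rewrite (leq_trans (size_polyD _ _)) // size_polyN geq_max leq_maxl /=.
  by rewrite (leq_trans (size_polyC_leq1 _)) ?leq_maxr.
by rewrite leq_max in sz; case/orP: sz => /(leq_sub2r 1); rewrite !subn1 // leqn0 => /eqP ->.
Qed.

Lemma op1_center a g : stack_multilinear g -> g [::] = 0 ->
  op1 k N (center a) g = comb (- phi (ev1 a)) g (op1 k N a g).
Proof.
move=> gl g0; case: a => [p|d]; rewrite /center; set c := phi _ => /=.
  rewrite addrC -polyCN -[(- c)%:P]mulr1 mul_polyC opP_lin; congr comb.
  by apply: functional_extensionality => st; rewrite opPC mul1r.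
apply: functional_extensionality => -[|t st]; rewrite /comb /=.
  by rewrite g0 mulr0 addr0.
by rewrite mulmxBr mul_mx_scalar addrC -scaleNr (gl [::]).
Qed.

Lemma merge a b : is_poly a = is_poly b ->
  exists c, [/\ ev1 c = ev1 a * ev1 b,
    forall g, op1 k N c g = op1 k N a (op1 k N b g)
    & (degree c <= degree a + degree b)%N].
Proof.
case: a b => [p|d] [q|d'] // _.
  exists (inl (p * q)); split=> [|g|]; first by rewrite !ev1_poly rmorphM.
    exact: opPM.
  have [->|p0] := eqVneq p 0; first by rewrite mul0r /= size_poly0.
  have [->|q0] := eqVneq q 0; first by rewrite mulr0 /= size_poly0.
  rewrite /= size_mul //; move: p0 q0; rewrite -!size_poly_gt0.
  by case: (size p) => // sp; case: (size q) => // sq _ _; rewrite addnS.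
exists (inr (d *m d')); split=> // [|g]; first exact: ev1_mxM.
by apply: functional_extensionality => -[|t st] //=; rewrite mulmxA.
Qed.

(** If the leading polynomial leaves identities above [d], the next letter turns the top one into a
    matrix of trace zero and the induction applies two letters further on. What remains is the mean
    of the polynomial, which is zero. The bound [m] is there because two letters are consumed at a
    time. *)
Lemma op_centered_vac m w d rest :
    (size w <= m)%N -> alternating w ->
    (forall a, a \in w -> phi (ev1 a) = 0) ->
    (sumn (map degree w) <= N)%N ->
    (if w is inr _ :: _ then False else True) ->
    ntr d = 0 \/ rest = [::] -> w <> [::] \/ rest <> [::] ->
  op k N w (@vac C n) (d :: rest) = 0.
Proof.
elim: m w d rest => [|m IH] [|a w] d rest //.
- by case: rest => // _ _ _ _ _ _ [].
- by case: rest => // _ _ _ _ _ _ [].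
case: a => // p wm alt cent deg _ d0 _ /=.
have gj j : (0 < j)%N -> op k N w (@vac C n) (nseq j 1%:M ++ d :: rest) = 0.
  case: j => // j _; case: w alt cent deg wm => [|[q|d'] w] /= alt cent deg wm.
  - by case: j.
  - by rewrite /alternating /= in alt.
  rewrite mul1mx; apply: IH => //.
  - by rewrite -ltnS ltnW.
  - by move: alt => /path_sorted.
  - by move=> a aw; apply: cent; rewrite !inE aw !orbT.
  - by rewrite (leq_trans _ deg) // leq_addl.
  - by case: w alt {deg wm cent} => [|[]].
  - by left; rewrite -phi_mx; apply: cent; rewrite !inE eqxx orbT.
  - by right; case: j.
rewrite opP_bottom ?op_nil //.
have -> : \sum_(i < size p) p`_i * path_sum k N i 0 = phi (ev1 (inl p)).
  rewrite /= phi_sum; apply: eq_bigr => i _; rewrite phiZ phi_x //.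
  move: deg => /= deg; rewrite (leq_trans _ (leq_trans (leq_addr _ _) deg)) //.
  by rewrite -ltnS (ltn_predK (ltn_ord i)).
by rewrite cent ?mul0r // inE eqxx.
Qed.

Lemma op_centered w : w <> [::] -> alternating w ->
    (forall a, a \in w -> phi (ev1 a) = 0) ->
    (sumn (map degree w) <= N)%N ->
  op k N w (@vac C n) [:: 1%:M] = 0.
Proof.
case: w => // -[p|d] w _ alt cent deg.
  by apply: (op_centered_vac (leqnn _)) => //; [right | left].
rewrite /= mul1mx; have d0 : ntr d = 0.
  by rewrite -phi_mx; apply: cent; rewrite inE eqxx.
case: w alt cent deg => [//|a w] alt cent deg.
apply: (op_centered_vac (leqnn _)) => //.
- exact: path_sorted alt.
- by move=> b bw; apply: cent; rewrite inE bw orbT.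
- by case: a alt {cent deg}.
- by left.
- by left.
Qed.

Lemma ev_centered w : w <> [::] -> alternating w ->
  (forall a, a \in w -> phi (ev1 a) = 0) -> phi (ev w) = 0.
Proof.
case: w => // a w _ alt cent; rewrite /ev -(big_map ev1 xpredT id).
apply: (free (b := is_poly a)) => //; last first.
  by move=> _ /mapP[b bw ->]; apply: cent.
rewrite size_map => i iw; rewrite (nth_map a) //.
have -> : odd i (+) is_poly a = is_poly (nth a (a :: w) i).
  elim: i iw => [//|i IH] iw; have iw' := ltnW iw.
  have := sortedP a alt i iw; rewrite -(IH iw') /=.
  by case: (odd i); case: (is_poly a); case: is_poly.
case: nth => [p|d] /=; first by exists p.
by exists (fun i j => d i j).
Qed.

Lemma not_alternating w : ~~ alternating w ->
  exists w1 a b w2, w = w1 ++ [:: a, b & w2] /\ is_poly a = is_poly b.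
Proof.
elim: w => // a [|b w] IH //; rewrite /alternating /= negb_and negbK.
case/orP=> [/eqP ab|/IH[w1 [c [d [w2 [-> cd]]]]]].
  by exists [::], a, b, w.
by exists (a :: w1), c, d, w2.
Qed.

Lemma ev_cat w1 w2 : ev (w1 ++ w2) = ev w1 * ev w2.
Proof. by rewrite /ev big_cat. Qed.

Lemma ev_cons a w : ev (a :: w) = ev1 a * ev w.
Proof. by rewrite /ev big_cons. Qed.

Lemma op_cat w1 w2 g : op k N (w1 ++ w2) g = op k N w1 (op k N w2 g).
Proof. by rewrite /op foldr_cat. Qed.

(** Induction on the length. Centring a letter changes both sides by the same multiple of their
    values at a shorter word. Once all letters are centred, either the word is empty, or it
    alternates and both sides vanish, or two neighbours of the same kind merge. *)
Theorem moment_op w : (sumn (map degree w) <= N)%N ->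
  phi (ev w) = op k N w (@vac C n) [:: 1%:M].
Proof.
move: {-1}(size w) (erefl (size w)) => m; elim/ltn_ind: m w => m IHm.
(* [u] collects the letters already centred and [v] those still to be treated. *)
suff H v u : size (u ++ v) = m -> (forall a, a \in u -> phi (ev1 a) = 0) ->
    (sumn (map degree (u ++ v)) <= N)%N ->
    phi (ev (u ++ v)) = op k N (u ++ v) (@vac C n) [:: 1%:M].
  by move=> w wm; apply: (H w [::]).
elim: v u => [|a v IHv] u.
  rewrite cats0 => um cent deg; have [alt|] := boolP (alternating u).
    case: u um cent deg alt => [|a u] um cent deg alt.
      by rewrite /ev big_nil phi1 /= ntr1.
    by rewrite ev_centered // op_centered.
  case/not_alternating=> [w1 [a [b [w2 [eu ab]]]]].
  have [c [evc opc degc]] := merge ab.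
  rewrite eu ev_cat !ev_cons [ev1 a * _]mulrA -evc -ev_cons -ev_cat op_cat /= -opc.
  rewrite -[op1 _ _ c _]/(op k N (c :: w2) _) -op_cat; apply: (IHm _ _ _ erefl).
    by rewrite -um eu !size_cat /= ltn_add2l.
  move: deg; rewrite eu !map_cat !sumn_cat /=; apply: leq_trans.
  by rewrite leq_add2l addnA leq_add2r.
move=> um cent deg.
have degS : (degree (center a) + sumn (map degree (u ++ v)) <= N)%N.
  move: deg; rewrite !map_cat !sumn_cat /= addnCA; apply: leq_trans.
  by rewrite leq_add2r degree_center.
have H1 : phi (ev (rcons u (center a) ++ v))
    = op k N (rcons u (center a) ++ v) (@vac C n) [:: 1%:M].
  apply: IHv => [|b|].
  - by rewrite -um !size_cat size_rcons addSnnS.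
  - by rewrite mem_rcons inE => /orP[/eqP ->|/cent //]; rewrite center_mean0.
  - by move: degS; rewrite cat_rcons !map_cat !sumn_cat /= addnCA.
have H2 : phi (ev (u ++ v)) = op k N (u ++ v) (@vac C n) [:: 1%:M].
  apply: (IHm _ _ _ erefl); first by rewrite -um !size_cat /= addnS.
  exact: leq_trans (leq_addl _ _) degS.
move: H1; rewrite cat_rcons !ev_cat ev_cons ev1_center mulrBl mulr_algl mulrBr.
rewrite -scalerAr addrC -scaleNr phi_lin -!ev_cat.
rewrite !op_cat /= op1_center ?op_nil //; last exact: op_multilinear.
rewrite op_comb /comb -[op _ _ u (op _ _ v _)]op_cat -H2 => /addrI.
by rewrite ev_cat ev_cons.
Qed.

(** [g] stands for [a] as the right end of any word, [q] being the degree set aside for [a]. Since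
    [w] is arbitrary, further letters can be put in front of [a], and sums of words need no
    expansion. *)
Definition represents (q : nat) (a : A) g := forall w,
  (sumn (map degree w) + q <= N)%N ->
  phi (ev w * a) = op k N w g [:: 1%:M].

Lemma represents1 : represents 0 1 (@vac C n).
Proof. by move=> w; rewrite addn0 mulr1 => /moment_op. Qed.

Lemma represents_mx q d a g :
  represents q a g -> represents q (ev1 (inr d) * a) (opM d g).
Proof.
move=> ag w wN; have evd : ev [:: inr d] = ev1 (inr d) by rewrite /ev big_seq1.
rewrite -evd mulrA -ev_cat.
rewrite -[opM d g]/(op k N [:: inr d] g) -op_cat; apply: ag.
by rewrite map_cat sumn_cat /= !addn0.
Qed.

Lemma represents_x q a g :
  represents q a g -> represents q.+1 (x * a) (opX k N g).
Proof.
move=> ag w wN; have evX : ev [:: inl 'X] = x.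
  by rewrite /ev big_seq1 ev1_poly horner_algX.
have -> : opX k N g = op k N [:: inl 'X] g.
  rewrite /= -['X]mul1r opPMX; apply: functional_extensionality => st.
  by rewrite opPC mul1r.
rewrite -{1}evX mulrA -ev_cat -op_cat; apply: ag.
by rewrite map_cat sumn_cat /= size_polyX /= addn0 addn1 addSnnS.
Qed.

Lemma represents_lin q c a b g f : represents q a g -> represents q b f ->
  represents q (c *: a + b) (comb c g f).
Proof.
move=> ag bf w wN; rewrite op_comb /comb mulrDr -scalerAr phi_lin.
by rewrite ag // bf.
Qed.

Lemma represents0 q : represents q 0 (fun=> 0).
Proof.
move=> w _; have -> : (fun=> 0) = comb (-1) (@vac C n) (@vac C n).
  by apply: functional_extensionality => st; rewrite /comb mulN1r addNr.
by rewrite op_comb /comb mulN1r addNr mulr0 phi0.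
Qed.

Lemma represents_sum q (I : Type) (r : seq I) (a : I -> A)
    (g : I -> seq 'M[C]_n -> C) :
  (forall i, represents q (a i) (g i)) ->
  represents q (\sum_(i <- r) a i) (fun st => \sum_(i <- r) g i st).
Proof.
move=> ag; elim: r => [|i r IH].
  rewrite big_nil (_ : (fun _ => _) = fun=> 0); first exact: represents0.
  by apply: functional_extensionality => st; rewrite big_nil.
rewrite big_cons (_ : (fun _ => _)
  = comb 1 (g i) (fun st => \sum_(i <- r) g i st)).
  by rewrite -[a i]scale1r; apply: represents_lin.
by apply: functional_extensionality => st; rewrite big_cons /comb mul1r.
Qed.

Lemma ev1_delta a c : ev1 (inr (delta_mx a c)) = e a c.
Proof.
rewrite /= (bigD1 a) //= [X in _ + X]big1 ?addr0 => [|i ia]; last first.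
  by rewrite big1 // => j _; rewrite mxE (negPf ia) scale0r.
rewrite (bigD1 c) //= big1 ?addr0 => [|j jc]; last first.
  by rewrite mxE (negPf jc) andbF scale0r.
by rewrite mxE !eqxx scale1r.
Qed.

Variables (i1 o : 'I_n).

Fixpoint chain_word (q : nat) (a b : 'I_n) : A :=
  if q is q'.+1 then \sum_c x * (e a c * chain_word q' b c)
  else ((a == i1) && (b == o))%:R%:A.

Lemma represents_chain q a b :
  represents q (chain_word q a b) (chain k N i1 o q a b).
Proof.
elim: q a b => [|q IH] a b /=.
  rewrite -[_%:A]addr0; apply: represents_lin; first exact: represents1.
  exact: represents0.
apply: represents_sum => c; apply: represents_x.
by rewrite -ev1_delta; apply: represents_mx.
Qed.

(** Between consecutive factors [e a o * e o c] collapses to [e a c], which leaves the words of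
    [chain_word] and one unit in front. *)
Lemma xGamma_exp q a :
  foldr mulmx (e o o)%:M (nseq q (xGamma e o x)) a i1
  = \sum_b e o b * chain_word q a b.
Proof.
elim: q a => [|q IH] a /=.
  rewrite (bigD1 o) //= big1 ?addr0 => [|b bo]; last first.
    by rewrite (negPf bo) andbF scale0r mulr0.
  by rewrite mxE eqxx andbT mulr_algr scaler_nat.
rewrite mxE; apply: eq_bigr => b _; rewrite mxE IH -!mulrA; congr (_ * _).
rewrite !mulr_sumr; apply: eq_bigr => c _.
by rewrite [e a o * _]mulrA eM eqxx.
Qed.

End Word.

Lemma xGamma_moment (A : algType C) (phi : A -> C) (e : 'I_n -> 'I_n -> A) x
    (o : 'I_n) :
    (forall (c : C) (a b : A), phi (c *: a + b) = c * phi a + phi b) ->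
    phi 1 = 1 ->
    (forall i j k l, e i j * e k l = if j == k then e i l else 0) ->
    \sum_(i < n) e i i = 1 ->
    (forall i j, phi (e i j) = (i == j)%:R / n%:R) ->
    free_pair phi (alg_gen1 x) (span_units e) ->
    (forall q, (q <= N)%N -> phi (x ^+ q) = path_sum k N q 0) ->
  tr_psi phi (foldr mulmx (e o o)%:M (nseq N (xGamma e o x)))
  = path_sum (weight n k) N N 0.
Proof.
move=> phi_lin phi1 eM e_sum1 phi_e free phi_x; have n0 := natC_neq0 C n_gt0.
(* The factor [n] of [psi] cancels the normalisation of the trace; each diagonal entry then
   contributes [n^-1] times the path sum. *)
rewrite /tr_psi /psi -mulr_sumr mulKf //.
transitivity (\sum_(i < n) path_sum (weight n k) N N 0 / n%:R).
  apply: eq_bigr => i _; rewrite xGamma_exp // (phi_sum phi_lin).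
  have := sum_chain k N n_gt0 i o N i o [::]; rewrite /= !eqxx mul1r => <-.
  apply: eq_bigr => b _; have evb : ev e x [:: inr (delta_mx o b)] = e o b.
    by rewrite /ev big_seq1 ev1_delta.
  rewrite -evb (represents_chain phi_lin phi1 eM e_sum1 phi_e free phi_x) //=.
  by rewrite mul1mx.
by rewrite sumr_const card_ord -[LHS]mulr_natr mulfVK.
Qed.

End FockMoments.

(** * Homogeneity of cumulants and the conclusion *)

Lemma cumulantZ (C : numClosedFieldType) (A : algType C) (phi : A -> C)
    (kappa : seq A -> C) (c : C) (x : A) (p : nat) :
  free_cumulants (fun (c : C) (a : A) => c *: a) *%R 1 predT phi kappa ->
  kappa (nseq p (c *: x)) = c ^+ p * kappa (nseq p x).
Proof.
case=> lin _; have linZ s1 s2 u : kappa (s1 ++ c *: u :: s2)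
    = c * kappa (s1 ++ u :: s2).
  have E := lin s1 s2 _ _ 0 (all_predT _) (all_predT _) isT isT.
  have k0 : kappa (s1 ++ 0 :: s2) = 0.
    have := E 1 0; rewrite scale1r addr0 mul1r => /esym/eqP.
    by rewrite -subr_eq0 addrK => /eqP.
  by have := E c u; rewrite addr0 k0 addr0.
(* Scalars are taken out of one entry at a time, from the left; the first [m] entries have been
   treated. *)
suff H m q : kappa (nseq m x ++ nseq q (c *: x))
    = c ^+ q * kappa (nseq (m + q) x) by apply: (H 0%N).
elim: q m => [|q IH] m; first by rewrite cats0 addn0 mul1r.
rewrite /= linZ exprS -mulrA addnS -addSn -IH; congr (_ * kappa _).
by rewrite -[x :: _]cat1s catA -[[:: x]]/(nseq 1 x) -nseqD addn1.
Qed.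

Theorem theorem1 (C : numClosedFieldType) (A : algType C) (n : nat)
    (hn : (0 < n)%N) (star : A -> A) (phi : A -> C)
    (e : 'I_n -> 'I_n -> A) (x : A) :
  star_prob_space star phi ->
  matrix_units star phi e ->
  star x = x ->
  free_pair phi (alg_gen1 x) (span_units e) ->
  forall (kappaM : seq 'M[A]_n -> C) (kappaA : seq A -> C),
    free_cumulants (@scale_mx C A n) mulmx (e (Ordinal hn) (Ordinal hn))%:M
      (in_corner_mx (e (Ordinal hn) (Ordinal hn))) (@tr_psi C A phi n) kappaM ->
    free_cumulants (fun (c : C) (a : A) => c *: a) *%R 1 predT phi kappaA ->
    forall p : nat, (0 < p)%N ->
      kappaM (nseq p (xGamma e (Ordinal hn) x))
        = (if odd p then n%:R else n%:R ^+ 2)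
          * kappaA (nseq p (n%:R^-1 *: x)).
Proof.
move=> [_ phi_lin _ phi1] [_ eM e_sum1 phi_e0 phi_e1] _ free kM kA cM cA p p_gt0.
pose k s := kA (nseq s x); set o := Ordinal hn.
have -> : kA (nseq p (n%:R^-1 *: x)) = k p / n%:R ^+ p.
  by rewrite (cumulantZ _ _ _ cA) mulrC exprVn.
(* The right-hand side is [weight n k p], so it suffices to compare moments of every order. *)
apply: (@nc_sum_inj _ (fun s => kM (nseq s (xGamma e o x))) (weight n k)) => //.
move=> {p_gt0}p p_gt0; rewrite -(moment_nc_sum cM) //; last first.
  apply/forallP => i; apply/forallP => j; rewrite mxE !mulrA eM eqxx.
  by rewrite -!mulrA eM eqxx.
(* The cut-off [N] is chosen equal to the order [p] of the moment. *)
rewrite (nc_sumT _ (leqnn p)); apply: xGamma_moment => //.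
  by move=> i j; case: eqVneq => [<-|/phi_e0 ->]; rewrite ?phi_e1 ?mul1r ?mul0r.
move=> [|q] qp; first by rewrite expr0 phi1 path_sum0.
rewrite -nc_sumT // -(moment_nc_sum cA) //; congr phi.
by elim: (q.+1) => [|m IH]; rewrite ?expr0 // exprS IH.
Qed.
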